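(* Let $A$ be a commutative unital real algebra and let $A_1,\dots,A_m$, $m\in\mathbb{N}$, be subalgebras of $A$, each containing the unit element of $A$, such that the algebra $A$ is generated by $A_1,\dots,A_m$. For each $i=1,\dots,m$ let $C_i$ be an Archimedean semiring or an Archimedean quadratic module of the algebra $A_i$. Let $a\in A$. Then the following two statements are equivalent: (i) $\chi(a)>0$ for all characters $\chi\in\bigcap_{i=1}^m\mathrm{char}(A;C_i)$. (ii) There is a number $\varepsilon>0$ such that $a\in\varepsilon+\mathrm{cone}(C_1,\dots,C_m)$.
   Context: For $\alpha\in\mathbb{R}$ we write $\alpha$ for $\alpha\cdot 1$ in an algebra. Let $B$ be a commutative unital real algebra. A cone in $B$ is a subset $C\subseteq B$ with $\lambda c\in C$ and $c+d\in C$ for all $c,d\in C$ and real $\lambda\ge 0$; it is unital if $1\in C$. A unital cone $C$ of $B$ is: - a quadratic module of $B$ if $a^2b\in C$ for all $b\in C$, $a\in B$; - a semiring of $B$ if $C\cdot C\subseteq C$; - Archimedean (in $B$) if for each $a\in B$ there is $\lambda>0$ with $\lambda-a\in C$ and $\lambda+a\in C$. If $C_1,\dots,C_n$ are unital cones of subalgebras of $A$ (each containing $1$), then $\mathrm{cone}(C_1,\dots,C_n)$ is the set of all finite sums $\sum_{k=1}^r c_{1k}\cdots c_{nk}$ with $r\in\mathbb{N}$ and $c_{jk}\in C_j$. A character of $A$ is a unital algebra homomorphism $A\to\mathbb{R}$. For a subset $C\subseteq A$, $\mathrm{char}(A;C)$ is the set of characters $\chi$ of $A$ with $\chi(c)\ge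 0$ for all $c\in C$. *)

(* Defs.v *)
From HB Require Import structures.
From mathcomp Require Import all_boot all_order all_algebra.
From mathcomp Require Import all_classical all_reals.

Set Implicit Arguments.
Unset Strict Implicit.
Unset Printing Implicit Defensive.

Import Order.TTheory GRing.Theory Num.Theory.

Local Open Scope classical_set_scope.
Local Open Scope ring_scope.

Section Defs.
Context {R : realType} {A : comAlgType R}.
Implicit Types B C S : set A.

(* [GRing.subalg_closed] includes [1 \in S], so the unit of a subalgebra is the
   unit of the ambient algebra. *)
Definition subalgebra S : Prop := GRing.subalg_closed (mem S).

Definition generated_subalgebra S : set A := smallest subalgebra S.

(* The algebra in which cones, quadratic modules, semirings and the Archimedean
   property are considered is a subalgebra [B] of the ambient type [A]. *)
Definition cone_in B C : Prop :=
  [/\ C `<=` B,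
      forall (l : R) c, 0 <= l -> C c -> C (l *: c) &
      forall c d, C c -> C d -> C (c + d)].

Definition unital_cone B C : Prop := cone_in B C /\ C 1.

Definition quadratic_module B C : Prop :=
  unital_cone B C /\ forall a b, B a -> C b -> C (a ^+ 2 * b).

Definition semiring B C : Prop :=
  unital_cone B C /\ forall c d, C c -> C d -> C (c * d).

Definition archimedean B C : Prop :=
  forall a, B a -> exists l : R, [/\ 0 < l, C (l%:A - a) & C (l%:A + a)].

(* The number [r] of summands may be zero; when [0 < n] and the [C j] are unital
   cones, the empty sum adds nothing, since [0] belongs to each [C j]. *)
Definition product_cone n (C : 'I_n -> set A) : set A :=
  [set x | exists (r : nat) (c : 'I_n -> 'I_r -> A),
     (forall j k, C j (c j k)) /\ x = \sum_(k < r) \prod_(j < n) c j k].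

Definition char_nonneg C : set {lrmorphism A -> R | *%R} :=
  [set chi | forall c, C c -> 0 <= chi c].

End Defs.

(* Main.v *)
Require Import Defs.
From HB Require Import structures.
From mathcomp Require Import all_boot all_order all_algebra.
From mathcomp Require Import all_classical all_reals.
From mathcomp Require Import ring lra.

Set Implicit Arguments.
Unset Strict Implicit.
Unset Printing Implicit Defensive.

Import Order.TTheory GRing.Theory Num.Theory.

Local Open Scope classical_set_scope.
Local Open Scope ring_scope.

(** The substance is that (i) implies (ii). Write [C] for the cone of the family,
    [D] for its closure [cone_closure C], the set of all [x] such that [x + e]
    belongs to [C] for every real [e > 0], and [T] for the semiring of multipliers
    of [D], the elements [t] with [t * D] contained in [D]. It is enough to find
    [d > 0] with [a - d] in [D], because then [a - d / 2] belongs to [C].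

    The cone [C] itself is in general neither a semiring nor a quadratic module,
    but the semiring [T] is Archimedean in the whole algebra. Its bounded elements
    form a subalgebra ([bounded_subalgebra]), so it suffices to bound the elements
    of each given subalgebra ([archimedean_multipliers]). For a slot whose cone is
    a semiring, this cone consists of multipliers of [C], and there is little to
    do. For a slot whose cone is a quadratic module, squares are multipliers, but
    the nonnegativity of [l - b ^+ 2] does not obviously survive multiplication by
    an element of the cone. With [y = b ^+ 2 / l], [1 - y] is approximated by
    squares of polynomials in [y]; the error is a polynomial in [y] with
    nonnegative coefficients whose sum is small, and it remains small when
    multiplied by a bounded element of [C] ([one_sub_mul_closure]).

    Once [T] is an Archimedean semiring and [D] a module over it, the theorem is a
    Kadison-Dubois representation theorem for modules
    ([archimedean_module_positivstellensatz]). A proper module extends to a maximal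
    one by Zorn's lemma; a maximal module is total; and a total module defines a
    total preorder on the algebra with order unit [1], whose standard part map is
    a character, as the infinitesimals form an ideal
    ([total_module_character]). Applied to the module generated by [D] and [- a],
    this yields [t] in [T] with [t * a - 1] in [D], from which a short descent
    gives [a - d] in [D]. *)

(** * Unital cones and modules over them *)

Section Cones.
Context {R : realType} {A : comAlgType R}.
Implicit Types (B C T P M : set A) (x y : A) (l r e : R).

Local Notation scal := (in_alg A).

Lemma unital_coneD B C x y : unital_cone B C -> C x -> C y -> C (x + y).
Proof. by case=> -[_ _ +] _; apply. Qed.

Lemma unital_coneZ B C l x : unital_cone B C -> 0 <= l -> C x -> C (scal l * x).
Proof. by case=> -[_ + _] _ => /[apply] /[apply]; rewrite mulr_algl. Qed.

Lemma unital_cone_scal B C l : unital_cone B C -> 0 <= l -> C (scal l).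
Proof.
by move=> hC l0; rewrite -[scal l]mulr1; apply: (unital_coneZ hC l0); case: hC.
Qed.

Lemma unital_cone0 B C : unital_cone B C -> C 0.
Proof. by move=> hC; rewrite -(rmorph0 scal); apply: (unital_cone_scal hC). Qed.

Lemma unital_cone_scalK B C l x :
  unital_cone B C -> 0 < l -> C (scal l * x) -> C x.
Proof.
move=> hC l0 Cx; have -> : x = scal l^-1 * (scal l * x).
  by rewrite mulrA -rmorphM mulVf ?gt_eqF// rmorph1 mul1r.
by apply: (unital_coneZ hC _ Cx); rewrite invr_ge0 ltW.
Qed.

Definition cone_module T M : Prop :=
  unital_cone setT M /\ forall t x, T t -> M x -> M (t * x).

Lemma cone_module_sub T M : cone_module T M -> T `<=` M.
Proof. by move=> [[_ M1] TM] t Tt; rewrite -[t]mulr1; apply: TM. Qed.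

(** * Characters from total modules *)

Section Characters.
Variables T P : set A.
Hypotheses (archT : archimedean setT T) (modP : cone_module T P).
Hypothesis (P_proper : ~ P (- 1)).
Hypothesis (P_total : forall x, P x \/ P (- x)).

Let coneP : unital_cone setT P := modP.1.

(** The value of the future character at [x] is the scalar that [x] equals up to
    infinitesimals of the total preorder with positive cone [P]. *)
Definition infinitesimally_near x r : Prop :=
  forall e, 0 < e -> P (x - scal r + scal e) /\ P (scal r - x + scal e).
Local Notation near := infinitesimally_near.

Lemma proper_scal_ge0 r : P (scal r) -> 0 <= r.
Proof.
move=> Pr; rewrite leNgt; apply/negP => r0; apply: P_proper.
apply: (unital_cone_scalK coneP (l := - r)); first by rewrite oppr_gt0.
by rewrite mulrN1 -rmorphN opprK.
Qed.

Lemma near_uniq x r s : near x r -> near x s -> r = s.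
Proof.
suff le u v : near x u -> near x v -> u <= v.
  by move=> xr xs; apply/eqP; rewrite eq_le !le.
move=> xu xv; rewrite leNgt; apply/negP => vu.
have e0 : 0 < (u - v) / 4 by lra.
have /proper_scal_ge0 : P (scal (v - u + ((u - v) / 4 + (u - v) / 4))).
  rewrite !rmorphD rmorphN.
  set E := scal ((u - v) / 4).
  have -> : scal v - scal u + (E + E)
    = (x - scal u + E) + (scal v - x + E) by ring.
  by apply: (unital_coneD coneP); [case: (xu _ e0)|case: (xv _ e0)].
lra.
Qed.

(** A Dedekind cut: [r] is the supremum of the scalars below [x], which exists
    because [T] bounds [x]; by totality [x] lies below every larger scalar. *)
Lemma near_exists x : exists r, near x r.
Proof.
have [l [l0 Tm Tp]] := archT (a := x) I.
have [Pm Pp] : P (scal l - x) /\ P (scal l + x).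
  by split; apply: cone_module_sub modP _ _.
pose S := [set r | P (x - scal r)].
have S_ub : ubound S l.
  move=> r Sr; rewrite -subr_ge0; apply: proper_scal_ge0.
  have -> : scal (l - r) = (scal l - x) + (x - scal r) by rewrite rmorphB; ring.
  exact: (unital_coneD coneP).
have S_sup : has_sup S.
  split; last by exists l.
  by exists (- l); have : P (x - scal (- l)) by rewrite rmorphN opprK addrC.
exists (sup S) => e e0; split.
  have [s Ss es] := sup_adherent e0 S_sup.
  have -> : x - scal (sup S) + scal e = (x - scal s) + scal (s - (sup S - e)).
    by rewrite !rmorphB; ring.
  apply: (unital_coneD coneP) => //.
  by apply: (unital_cone_scal coneP); rewrite subr_ge0 ltW.
have [Px|] := P_total (x - scal (sup S + e)).
  have : sup S + e <= sup S by apply: ub_le_sup => //; case: S_sup.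
  lra.
by congr P; rewrite rmorphD; ring.
Qed.

Lemma near1 : near 1 1.
Proof.
move=> e e0; rewrite rmorph1 subrr add0r.
by split; apply: (unital_cone_scal coneP); exact: ltW.
Qed.

Lemma nearD x y r s : near x r -> near y s -> near (x + y) (r + s).
Proof.
move=> xr ys e e0; have e20 : 0 < e / 2 by lra.
have [xr1 xr2] := xr _ e20; have [ys1 ys2] := ys _ e20.
have -> : e = e / 2 + e / 2 by lra.
rewrite !rmorphD; set E := scal (e / 2); split.
  have -> : x + y - (scal r + scal s) + (E + E)
    = (x - scal r + E) + (y - scal s + E) by ring.
  exact: (unital_coneD coneP).
have -> : scal r + scal s - (x + y) + (E + E)
    = (scal r - x + E) + (scal s - y + E) by ring.
exact: (unital_coneD coneP).
Qed.

Lemma nearN x r : near x r -> near (- x) (- r).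
Proof.
move=> xr e /xr [h1 h2]; rewrite rmorphN; split.
  by rewrite addrC opprK in h2 *; rewrite addrC [- x + _]addrC.
by rewrite opprK [- _ + _]addrC.
Qed.

(** Infinitesimals are stable under [T]: if [t <= l], then multiplying
    [- d <= x <= d] by [t] gives [- d * l <= t * x <= d * l]. *)
Lemma near0M_T t x : T t -> near x 0 -> near (t * x) 0.
Proof.
move=> Tt x0 e e0; have [l [l0 Tm _]] := archT (a := t) I.
have Pm : P (scal l - t) by apply: cone_module_sub modP _ _.
have d0 : 0 < e / l by rewrite divr_gt0.
have -> : e = e / l * l by rewrite divfK ?gt_eqF.
have [] := x0 _ d0; rewrite rmorph0 subr0 sub0r => h1 h2.
rewrite subr0 sub0r rmorphM; set d := scal (e / l) in h1 h2 *.
have Pd : P (d * (scal l - t)) by apply: (unital_coneZ coneP (ltW d0)).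
split.
  have -> : t * x + d * scal l = t * (x + d) + d * (scal l - t) by ring.
  by apply: (unital_coneD coneP) => //; apply: modP.2.
have -> : - (t * x) + d * scal l = t * (- x + d) + d * (scal l - t) by ring.
by apply: (unital_coneD coneP) => //; apply: modP.2.
Qed.

(** Every [y] is a difference of two elements of [T], namely [l + y] and [l], so
    the infinitesimals form an ideal. This is what makes the standard part
    multiplicative. *)
Lemma near0M x y : near x 0 -> near (x * y) 0.
Proof.
move=> x0; have [l [l0 _ Tp]] := archT (a := y) I.
have -> : x * y = (scal l + y) * x - scal l * x by ring.
rewrite -(subr0 0); apply: nearD; first exact: near0M_T.
rewrite -oppr0; apply: nearN => e e0.
have [] := x0 (e / l); first by rewrite divr_gt0.
have -> : scal e = scal l * scal (e / l).
  by rewrite -rmorphM mulrC divfK ?gt_eqF.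
rewrite oppr0 rmorph0 !subr0 !sub0r -mulrN -!mulrDr => h1 h2.
by split; apply: (unital_coneZ coneP (ltW l0)).
Qed.

Lemma near_scal r : near (scal r) r.
Proof.
move=> e e0; rewrite subrr add0r.
by split; apply: (unital_cone_scal coneP); exact: ltW.
Qed.

Lemma nearM x y r s : near x r -> near y s -> near (x * y) (r * s).
Proof.
move=> xr ys.
suff : near ((x - scal r) * y + ((y - scal s) * scal r + scal (r * s)))
    (0 + (0 + r * s)).
  by rewrite !add0r; congr (near _ _); rewrite rmorphM; ring.
apply: nearD.
  by apply: near0M; rewrite -(subrr r); apply: nearD xr (nearN (near_scal r)).
apply: nearD; last exact: near_scal.
by apply: near0M; rewrite -(subrr s); apply: nearD ys (nearN (near_scal s)).
Qed.

(** The standard part of the total preorder defined by [P] is linear and, as the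
    infinitesimals form an ideal, multiplicative. *)
Lemma total_module_character :
  exists chi : {lrmorphism A -> R | *%R}, forall x, P x -> 0 <= chi x.
Proof.
have /choice[f fP] := near_exists.
have fE x r : near x r -> f x = r by exact: near_uniq.
have f_lin : linear_for *%R f.
  move=> l x y; apply: fE; rewrite -mulr_algl.
  exact: nearD (nearM (near_scal l) (fP x)) (fP y).
have f_mul : monoid_morphism f.
  by split=> [|x y]; apply: fE; [exact: near1|exact: nearM].
pose L := GRing.isLinear.Build R A R *%R f f_lin.
pose M := GRing.isMonoidMorphism.Build A R f f_mul.
pose chi : {lrmorphism A -> R | *%R} := HB.pack f L M.
exists chi => x Px; rewrite /= leNgt; apply/negP => fx0.
have e0 : 0 < - f x / 2 by lra.
have /proper_scal_ge0 : P (scal (f x + - f x / 2)).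
  have [_ h] := fP x _ e0.
  rewrite rmorphD; set E := scal (- f x / 2).
  have -> : scal (f x) + E = x + (scal (f x) - x + E) by ring.
  exact: (unital_coneD coneP).
lra.
Qed.

End Characters.
End Cones.

(** * The Positivstellensatz for modules over Archimedean semirings *)

Section Positivstellensatz.
Context {R : realType} {A : comAlgType R}.
Implicit Types (T P M : set A) (x y a : A).

Local Notation scal := (in_alg A).

Definition adjoin T M x : set A :=
  [set y | exists p t, [/\ M p, T t & y = p + t * x]].

Lemma cone_module_adjoin T M x : semiring setT T -> cone_module T M ->
  cone_module T (adjoin T M x).
Proof.
move=> [coneT TT] [coneM TM].
have T0 : T 0 := unital_cone0 coneT.
split; first split; first split => //.
- move=> l y l0 [p [t [Mp Tt ->]]]; exists (scal l * p), (scal l * t); split.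
  + exact: (unital_coneZ coneM).
  + exact: (unital_coneZ coneT).
  + by rewrite -mulr_algl -[l%:A]/(scal l); ring.
- move=> y z [p [t [Mp Tt ->]]] [q [s [Mq Ts ->]]].
  exists (p + q), (t + s); split; last by ring.
  + exact: (unital_coneD coneM).
  + exact: (unital_coneD coneT).
- by exists 1, 0; split => //; [case: coneM|rewrite mul0r addr0].
- move=> s y Ts [p [t [Mp Tt ->]]].
  by exists (s * p), (s * t); split; [exact: TM|exact: TT|ring].
Qed.

Lemma cone_module_adjoin_sub T M x : semiring setT T ->
  M `<=` adjoin T M x.
Proof.
move=> [coneT _] p Mp; exists p, 0; split; rewrite ?mul0r ?addr0 //.
exact: (unital_cone0 coneT).
Qed.

(** In Zorn's lemma the candidates are the sets [X] for which [M `|` X] is a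
    proper module: since the empty set is one of them, the empty chain needs no
    separate treatment. *)
Lemma maximal_cone_module T M : cone_module T M -> ~ M (- 1) ->
  exists P, [/\ cone_module T P, ~ P (- 1), M `<=` P &
    forall Q, cone_module T Q -> ~ Q (- 1) -> P `<=` Q -> Q `<=` P].
Proof.
move=> modM M_proper.
pose Q := [set X | cone_module T (M `|` X) /\ ~ (M `|` X) (- 1)].
have Q0 : Q set0 by rewrite -[Q set0]/(_ /\ _) setU0.
have chainQ (F : set (set A)) : F `<=` Q -> total_on F subset ->
    Q (\bigcup_(X in F) X).
  move=> FQ Ftot; set U := \bigcup_(X in F) X.
  have one x : (M `|` U) x -> exists X, [/\ Q X, X `<=` U & (M `|` X) x].
    case=> [Mx|[X FX Xx]]; first by exists set0; split => //; left.
    by exists X; split; [exact: FQ|exact: bigcup_sup|right].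
  have two x y : (M `|` U) x -> (M `|` U) y ->
      exists X, [/\ Q X, X `<=` U, (M `|` X) x & (M `|` X) y].
    case=> [Mx|[X FX Xx]].
      by move=> /one[X [QX XU MXy]]; exists X; split => //; left.
    case=> [My|[Y FY Yy]].
      by exists X; split; [exact: FQ|exact: bigcup_sup|right|left].
    have [XY|YX] := Ftot _ _ FX FY.
      by exists Y; split; [exact: FQ|exact: bigcup_sup|right; exact: XY|right].
    by exists X; split; [exact: FQ|exact: bigcup_sup|right|right; exact: YX].
  have lift X x : X `<=` U -> (M `|` X) x -> (M `|` U) x.
    by move=> XU; apply: setUS.
  split; last by move=> /one[X [[_ +] _ ?]]; apply.
  split; first split; first split => //.
  - move=> l x l0 /one[X [QX XU Xx]]; apply: (lift X) => //.
    by case: QX => -[[[_ + _] _] _] _; apply.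
  - move=> x y Ux Uy; have [X [QX XU Xx Xy]] := two _ _ Ux Uy.
    apply: (lift X) => //.
    by case: QX => -[[[_ _ +] _] _] _; apply.
  - by left; case: modM => -[].
  - move=> t x Tt /one[X [QX XU Xx]]; apply: (lift X) => //.
    by case: QX => -[_ +] _; apply.
have [X [[modX X_proper] X_max]] := Zorn_bigcup chainQ.
exists (M `|` X); split; [exact: modX|exact: X_proper|exact: subsetUl|].
move=> Y modY Y_proper; rewrite subUset => -[MY XY] y Yy; right.
apply: contrapT => nXy; apply: (X_max Y).
  by split=> // /(_ y Yy).
by rewrite -[Q Y]/(_ /\ _) (setUidr MY).
Qed.

(** If neither [x] nor [- x] belongs to [P], both adjunctions contain [- 1]:
    [- 1 = p + t * x] and [- 1 = q - s * x]. Eliminating [x] shows that [- t]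
    lies in [P] along with [t], and then [t * x], a combination of [t] and [- t]
    with coefficients in [T], lies in [P], which forces [- 1] into [P]. *)
Lemma maximal_cone_module_total T P x :
    semiring setT T -> archimedean setT T -> cone_module T P -> ~ P (- 1) ->
    (forall Q, cone_module T Q -> ~ Q (- 1) -> P `<=` Q -> Q `<=` P) ->
  P x \/ P (- x).
Proof.
move=> srT archT modP P_proper P_max.
have [coneT TT] := srT; have [coneP TP] := modP.
have adj y : ~ P y -> exists p t, [/\ P p, T t & -1 = p + t * y].
  move=> nPy; apply: contrapT => nadj; apply: nPy.
  apply: (P_max _ (cone_module_adjoin y srT modP) nadj).
    exact: cone_module_adjoin_sub.
  exists 0, 1; split; last by ring.
    exact: (unital_cone0 coneP).
  by case: coneT.
apply: contrapT => /not_orP[/adj[p [t [Pp Tt pE]]] /adj[q [s [Pq Ts qE]]]].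
apply: P_proper.
have PNt : P (- t).
  have -> : - t = s * p + (t * q + s).
    have -> : p = - 1 - t * x by rewrite pE; ring.
    have -> : q = - 1 + s * x by rewrite qE; ring.
    ring.
  apply: (unital_coneD coneP); first exact: TP.
  by apply: (unital_coneD coneP); [exact: TP|exact: (cone_module_sub modP)].
have [l [l0 Tm _]] := archT x I.
rewrite pE; apply: (unital_coneD coneP) => //.
have -> : t * x = (scal l - x) * - t + scal l * t by ring.
apply: (unital_coneD coneP); first exact: TP.
by apply: (unital_coneZ coneP (ltW l0)); exact: (cone_module_sub modP).
Qed.

(** A character that is nonnegative on the module generated by [M] and [- a]
    would contradict the hypothesis, so this module is improper, which gives
    [t] in [T] with [t * a - 1] in [M]. Choose [k] with [k - t] in [T]. Then
    [k * (a + r) - 1 = (k - t) * (a + r) + (t * a - 1) + r * t], so membership of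
    [a + r] in [M] with [0 <= r] improves to that of [a + r - 1 / k]. Starting
    from a multiple of [1 / k], the descent passes below zero. *)
Theorem archimedean_module_positivstellensatz T M a :
    semiring setT T -> archimedean setT T -> cone_module T M ->
    (forall chi : {lrmorphism A -> R | *%R}, char_nonneg M chi -> 0 < chi a) ->
  exists2 d : R, 0 < d & M (a - d%:A).
Proof.
move=> srT archT modM a_gt0; have [coneM TM] := modM.
have [p [t [Mp Tt pE]]] : exists p t, [/\ M p, T t & -1 = p + t * - a].
  apply: contrapT => adj_proper.
  have modMa := cone_module_adjoin (- a) srT modM.
  have [P [modP P_proper MaP P_max]] := maximal_cone_module modMa adj_proper.
  have [chi chi_ge0] := total_module_character archT modP P_proper
    (fun x => maximal_cone_module_total x srT archT modP P_proper P_max).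
  have /a_gt0 : char_nonneg M chi.
    by move=> x Mx; apply: chi_ge0; apply: MaP; exact: cone_module_adjoin_sub.
  have : 0 <= chi (- a).
    apply: chi_ge0; apply: MaP; exists 0, 1; split; last by ring.
      exact: (unital_cone0 coneM).
    by case: srT => -[].
  by rewrite rmorphN; lra.
have [k [k0 Tk _]] := archT t I.
have step r : 0 <= r -> M (a + scal r) -> M (a + scal (r - k^-1)).
  move=> r0 Mar; apply: (unital_cone_scalK coneM k0).
  have -> : scal k * (a + scal (r - k^-1))
      = (scal k - t) * (a + scal r) + (p + scal r * t).
    have -> : p = t * a - 1 by rewrite -[- 1]opprK pE; ring.
    have kK : scal k * scal k^-1 = 1 by rewrite -rmorphM divff ?rmorph1 ?gt_eqF.
    by rewrite rmorphB; ring: kK.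
  apply: (unital_coneD coneM); first exact: TM.
  apply: (unital_coneD coneM) => //; apply: (unital_coneZ coneM) => //.
  exact: (cone_module_sub modM).
have [l [l0 _ Tl]] := archT a I.
have [n ln] : exists n : nat, l <= n%:R / k.
  exists (Num.bound (l * k)); rewrite ler_pdivlMr// ltW//.
  by apply: archi_boundP; rewrite mulr_ge0 ?ltW.
have : M (a + scal (n%:R / k)).
  have -> : a + scal (n%:R / k) = (scal l + a) + scal (n%:R / k - l).
    by rewrite rmorphB; ring.
  apply: (unital_coneD coneM); first exact: (cone_module_sub modM).
  by apply: (unital_cone_scal coneM); rewrite subr_ge0.
elim: n {ln} => [|n IHn] Mn.
  exists k^-1; first by rewrite invr_gt0.
  by rewrite mul0r in Mn; have := step 0 (lexx _) Mn; rewrite sub0r rmorphN.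
apply: IHn; have -> : n%:R / k = n.+1%:R / k - k^-1 by rewrite -natr1; ring.
by apply: step => //; rewrite divr_ge0 ?ler0n ?ltW.
Qed.
End Positivstellensatz.

(** * Multipliers of the closure of a cone *)

Section Multipliers.
Context {R : realType} {A : comAlgType R}.
Implicit Types (B C D T : set A) (b c t x y : A) (l e : R).

Local Notation scal := (in_alg A).

Definition cone_closure C : set A := [set x | forall e, 0 < e -> C (x + scal e)].

Definition multipliers D : set A := [set t | forall x, D x -> D (t * x)].

Lemma cone_closure_sub C : unital_cone setT C -> C `<=` cone_closure C.
Proof.
move=> coneC x Cx e e0; apply: (unital_coneD coneC) => //.
exact: (unital_cone_scal coneC) (ltW e0).
Qed.

Lemma cone_closure_unital_cone C :
  unital_cone setT C -> unital_cone setT (cone_closure C).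
Proof.
move=> coneC; split; last by apply: (cone_closure_sub coneC); case: coneC.
split => // [l x|x y Dx Dy e e0].
  rewrite le_eqVlt => /predU1P[<- _|l0 Dx e e0].
    rewrite scale0r; apply: (cone_closure_sub coneC).
    exact: (unital_cone0 coneC).
  have -> : l *: x + scal e = scal l * (x + scal (e / l)).
    by rewrite mulrDr -rmorphM mulr_algl mulrC divfK ?gt_eqF.
  apply: (unital_coneZ coneC); first exact: ltW.
  by apply: Dx; rewrite divr_gt0.
have e20 : 0 < e / 2 by lra.
have -> : x + y + scal e = (x + scal (e / 2)) + (y + scal (e / 2)).
  by rewrite {1}(_ : e = e / 2 + e / 2) ?rmorphD; [ring|lra].
by apply: (unital_coneD coneC); [exact: Dx|exact: Dy].
Qed.

Lemma multipliers_semiring D : unital_cone setT D -> semiring setT (multipliers D).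
Proof.
move=> coneD; split; last by move=> s t Ds Dt x Dx; rewrite -mulrA; exact/Ds/Dt.
split; last by move=> x Dx; rewrite mul1r.
split => // [l t l0 Dt x Dx|s t Ds Dt x Dx].
  by rewrite -scalerAl -mulr_algl; apply: (unital_coneZ coneD) => //; exact: Dt.
by rewrite mulrDl; apply: (unital_coneD coneD); [exact: Ds|exact: Dt].
Qed.

(** To pass from [C] to its closure, apply the hypothesis to [x + d] with [d]
    small; the error term [d * t] is absorbed by the bound [t <= l]. *)
Lemma multipliers_closure C t l : unital_cone setT C -> 0 < l -> C (scal l - t) ->
  (forall c, C c -> cone_closure C (t * c)) -> multipliers (cone_closure C) t.
Proof.
move=> coneC l0 Clt tC x Dx e e0.
have l10 : 0 < l + 1 by lra.
have d0 : 0 < e / (l + 1) by rewrite divr_gt0.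
have -> : e = e / (l + 1) * l + e / (l + 1).
  by rewrite -[X in _ + X]mulr1 -mulrDr divfK ?gt_eqF.
move: (e / (l + 1)) d0 => d d0.
have -> : t * x + scal (d * l + d)
    = (t * (x + scal d) + scal d) + scal d * (scal l - t).
  by rewrite rmorphD rmorphM; ring.
apply: (unital_coneD coneC); first exact: (tC _ (Dx _ d0)).
exact: (unital_coneZ coneC) (ltW d0) Clt.
Qed.

Lemma subalgebraP B : subalgebra B <->
  [/\ B 1, forall l x y, B x -> B y -> B (l *: x + y) &
      forall x y, B x -> B y -> B (x * y)].
Proof.
split=> [[B1 BL BM]|[B1 BL BM]]; split; first by rewrite inE in B1.
- by move=> l x y Bx By; have := BL l x y (mem_set Bx) (mem_set By); rewrite inE.
- by move=> x y Bx By; have := BM x y (mem_set Bx) (mem_set By); rewrite inE.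
- exact: mem_set.
- by move=> l x y /set_mem Bx /set_mem By; apply/mem_set/BL.
- by move=> x y /set_mem Bx /set_mem By; apply/mem_set/BM.
Qed.

Lemma bounded_subalgebra T : semiring setT T ->
  subalgebra [set x | exists l : R, [/\ 0 < l, T (scal l - x) & T (scal l + x)]].
Proof.
move=> [coneT TT]; apply/subalgebraP; split.
- exists 1; split => //; rewrite rmorph1; first rewrite subrr.
    exact: (unital_cone0 coneT).
  by apply: (unital_coneD coneT); case: coneT.
- move=> a x y [l [l0 Tlm Tlp]] [m [m0 Tmm Tmp]].
  exists (`|a| * l + m); split; first by have := mulr_ge0 (normr_ge0 a) (ltW l0); lra.
    have -> : scal (`|a| * l + m) - (a *: x + y)
        = scal `|a| * (scal l) - scal a * x + (scal m - y).
      by rewrite -mulr_algl -[a%:A]/(scal a) rmorphD rmorphM; ring.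
    apply: (unital_coneD coneT) => //; have [a0|a0] := leP 0 a.
      by rewrite ger0_norm// -mulrBr; exact: (unital_coneZ coneT).
    rewrite ltr0_norm// rmorphN mulNr -opprD -mulrDr -mulNr -rmorphN.
    by apply: (unital_coneZ coneT) => //; lra.
  have -> : scal (`|a| * l + m) + (a *: x + y)
      = scal `|a| * (scal l) + scal a * x + (scal m + y).
    by rewrite -mulr_algl -[a%:A]/(scal a) rmorphD rmorphM; ring.
  apply: (unital_coneD coneT) => //; have [a0|a0] := leP 0 a.
    by rewrite ger0_norm// -mulrDr; exact: (unital_coneZ coneT).
  rewrite ltr0_norm// rmorphN mulNr addrC -mulrBr -opprB mulrN -mulNr -rmorphN.
  by apply: (unital_coneZ coneT) => //; lra.
move=> x y [l [l0 Tlm Tlp]] [m [m0 Tmm Tmp]].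
have two0 : (0 : R) < 2 by [].
exists (l * m); split; first exact: mulr_gt0.
  apply: (unital_cone_scalK coneT two0).
  have -> : scal 2 * (scal (l * m) - x * y)
      = (scal l + x) * (scal m - y) + (scal l - x) * (scal m + y).
    by rewrite rmorphM rmorph_nat; ring.
  by apply: (unital_coneD coneT); exact: TT.
apply: (unital_cone_scalK coneT two0).
have -> : scal 2 * (scal (l * m) + x * y)
    = (scal l + x) * (scal m + y) + (scal l - x) * (scal m - y).
  by rewrite rmorphM rmorph_nat; ring.
by apply: (unital_coneD coneT); exact: TT.
Qed.

(** * Polynomial approximation of the square root of 1 - y *)

Section SquareRoot.
Variables B C : set A.
Hypotheses (subB : subalgebra B) (coneC : unital_cone setT C).
Hypothesis bddC : forall c, C c -> exists2 l, 0 <= l & C (scal l - c).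
Hypothesis sqrC : forall b c, B b -> C c -> C (b ^+ 2 * c).
Variable y : A.
Hypotheses (By : B y) (yC : forall c, C c -> C (y * c)) (y_le1 : C (1 - y)).

(** Pairs consisting of an element [z] and a real bound for it, where [z] stands
    for a polynomial in [y] with nonnegative coefficients and the bound for the
    value of this polynomial at [1]. *)
Definition dominated (p : A * R) : Prop :=
  [/\ 0 <= p.2, (forall c, C c -> C (p.1 * c)) & C (scal p.2 - p.1)].

Lemma dominatedD p q :
  dominated p -> dominated q -> dominated (p.1 + q.1, p.2 + q.2).
Proof.
move=> [p0 pC pp] [q0 qC qq]; split=> /=; first exact: addr_ge0.
  move=> c Cc; rewrite mulrDl.
  by apply: (unital_coneD coneC); [exact: pC|exact: qC].
have -> : scal (p.2 + q.2) - (p.1 + q.1) = (scal p.2 - p.1) + (scal q.2 - q.1).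
  by rewrite rmorphD; ring.
exact: (unital_coneD coneC).
Qed.

Lemma dominatedM p q :
  dominated p -> dominated q -> dominated (p.1 * q.1, p.2 * q.2).
Proof.
move=> [p0 pC pp] [q0 qC qq]; split=> /=; first exact: mulr_ge0.
  by move=> c Cc; rewrite -mulrA; apply/pC/qC.
have -> : scal (p.2 * q.2) - (p.1 * q.1)
    = scal q.2 * (scal p.2 - p.1) + p.1 * (scal q.2 - q.1).
  by rewrite rmorphM; ring.
by apply: (unital_coneD coneC); [exact: (unital_coneZ coneC)|exact: pC].
Qed.

Lemma dominatedZ l p :
  0 <= l -> dominated p -> dominated (scal l * p.1, l * p.2).
Proof.
move=> l0; apply: (@dominatedM (scal l, l)); split => //=.
  by move=> c; exact: (unital_coneZ coneC).
by rewrite subrr; exact: (unital_cone0 coneC).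
Qed.

(** With [y] standing for a number in the unit interval, the iteration
    [z -> (y + z ^+ 2) / 2] converges to [1 - sqrt (1 - y)]. The second
    component is the same iteration at [y = 1]. *)
Fixpoint sqrt_iter n : A * R :=
  if n is n'.+1 then
    let p := sqrt_iter n' in
    (scal 2^-1 * (y + p.1 * p.1), 2^-1 * (1 + p.2 * p.2))
  else (0, 0).

Lemma sqrt_iter_dominated n : dominated (sqrt_iter n).
Proof.
have half0 : (0 : R) <= 2^-1 by rewrite invr_ge0.
elim: n => [|n IHn] /=.
  split=> //= [c _|]; rewrite ?mul0r ?scale0r ?subr0;
    exact: (unital_cone0 coneC).
have dy : dominated (y, 1) by split; rewrite //= ?scale1r.
exact: (dominatedZ half0 (dominatedD dy (dominatedM IHn IHn))).
Qed.

Definition sqrt_step n : A * R :=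
  ((sqrt_iter n.+1).1 - (sqrt_iter n).1, (sqrt_iter n.+1).2 - (sqrt_iter n).2).

(** Steps satisfy [z'' - z' = (z' - z) * (z' + z) / 2], so they too are
    polynomials in [y] with nonnegative coefficients. *)
Lemma sqrt_step_dominated n : dominated (sqrt_step n).
Proof.
have half0 : (0 : R) <= 2^-1 by rewrite invr_ge0.
elim: n => [|n IHn].
  by have := sqrt_iter_dominated 1; rewrite /sqrt_step /= !subr0.
have := dominatedZ half0 (dominatedM IHn
  (dominatedD (sqrt_iter_dominated n.+1) (sqrt_iter_dominated n))).
by congr dominated; rewrite /sqrt_step /=; congr pair; ring.
Qed.

Lemma sqrt_iter_le1 n : (sqrt_iter n).2 <= 1.
Proof.
elim: n => [|n IHn] //=; have [n0 _ _] := sqrt_iter_dominated n.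
have := ler_pM n0 n0 IHn IHn; rewrite mulr1; lra.
Qed.

(** The real iterates increase and stay below [1], so their steps cannot all be
    at least [e]. *)
Lemma sqrt_step_small e : 0 < e -> exists n, (sqrt_step n).2 < e.
Proof.
move=> e0; apply: contrapT => /forallNP big.
have lower n : e * n%:R <= (sqrt_iter n).2.
  elim: n => [|n IHn]; first by rewrite mulr0.
  have /negP := big n; rewrite -leNgt lerBrDr.
  by rewrite -natr1 mulrDr mulr1; lra.
have := archi_boundP (ltW (divr_gt0 ltr01 e0)).
have := le_trans (lower (Num.bound (1 / e))) (sqrt_iter_le1 _).
by rewrite ltr_pdivrMr// mulrC => + ?; rewrite leNgt => /negP; apply.
Qed.

Lemma sqrt_iter_mem n : B (sqrt_iter n).1.
Proof.
have /subalgebraP[B1 BL BM] := subB.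
have B0 : B 0 by rewrite -(addNr 1) -scaleN1r; exact: BL.
elim: n => [|n IHn] //=.
rewrite mulr_algl -[_ *: _]addr0; apply: (BL) => //.
by rewrite -[y]scale1r; apply: (BL) => //; exact: BM.
Qed.

(** If [z] and [z'] are successive iterates, then
    [1 - y = (1 - z) ^+ 2 - 2 * (z' - z)]. The square maps [C] to itself, and if
    [c <= l] and [z' - z <= s], then [(z' - z) * c <= (z' - z) * l <= s * l], which
    is arbitrarily small. *)
Lemma one_sub_mul_closure c : C c -> cone_closure C ((1 - y) * c).
Proof.
move=> Cc e e0; have [l l0 Clc] := bddC Cc.
(* The error is [2 * l * s]; adding 1 keeps the denominator positive when
   [l = 0]. *)
have d0 : 0 < e / (2 * l + 1) by rewrite divr_gt0//; lra.
have [n nd] := sqrt_step_small d0.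
have [s0 sC sle] := sqrt_step_dominated n.
set s := sqrt_step n in nd s0 sC sle *.
have B1z : B (1 - (sqrt_iter n).1).
  have /subalgebraP[B1 BL _] := subB.
  by rewrite addrC -scaleN1r; apply: BL => //; exact: sqrt_iter_mem.
have le_e : 0 <= e - 2 * l * s.2.
  move: nd; rewrite ltr_pdivlMr; last lra.
  by nra.
have -> : (1 - y) * c + scal e = (1 - (sqrt_iter n).1) ^+ 2 * c
    + (scal 2 * (s.1 * (scal l - c)) + (scal (2 * l) * (scal s.2 - s.1)
    + scal (e - 2 * l * s.2))).
  have -> : (1 - y) * c = (1 - (sqrt_iter n).1) ^+ 2 * c - scal 2 * s.1 * c.
    have half : scal 2 * scal 2^-1 = 1 by rewrite -rmorphM divff ?rmorph1 ?pnatr_eq0.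
    have -> : s.1 = scal 2^-1 * (y + (sqrt_iter n).1 * (sqrt_iter n).1)
      - (sqrt_iter n).1 by [].
    rewrite mulrBr mulrA half rmorph_nat; ring.
  by rewrite !(rmorphB, rmorphM); ring.
apply: (unital_coneD coneC); first exact: sqrC.
apply: (unital_coneD coneC).
  by apply: (unital_coneZ coneC) => //; exact: sC.
apply: (unital_coneD coneC); last exact: (unital_cone_scal coneC).
by apply: (unital_coneZ coneC) => //; lra.
Qed.

End SquareRoot.
End Multipliers.

(** * The cone of a family of cones *)

Section ProductCone.
Context {R : realType} {A : comAlgType R}.

Local Notation scal := (in_alg A).

Lemma product_cone_prod n (C : 'I_n -> set A) (c : 'I_n -> A) :
  (forall j, C j (c j)) -> product_cone C (\prod_j c j).
Proof. by move=> Cc; exists 1%N, (fun j _ => c j); split=> //; rewrite big_ord1. Qed.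

Lemma product_cone0 n (C : 'I_n -> set A) : product_cone C 0.
Proof.
exists 0%N, (fun _ _ => 0); split; last by rewrite big_ord0.
by move=> j [].
Qed.

Lemma product_coneD n (C : 'I_n -> set A) x y :
  product_cone C x -> product_cone C y -> product_cone C (x + y).
Proof.
move=> [r [c [Cc ->]]] [s [d [Cd ->]]].
exists (r + s)%N, (fun j (k : 'I_(r + s)) =>
  match fintype.split k with inl k => c j k | inr k => d j k end).
split=> [j k|]; first by case: (fintype.split k).
rewrite big_split_ord /=.
congr (_ + _); apply: eq_bigr => k _; apply: eq_bigr => j _.
  by rewrite (unsplitK (inl k)).
by rewrite (unsplitK (inr k)).
Qed.

Lemma product_cone_ind n (C : 'I_n -> set A) (P : set A) :
  P 0 -> (forall x y, P x -> P y -> P (x + y)) ->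
  (forall c, (forall j, C j (c j)) -> P (\prod_j c j)) -> product_cone C `<=` P.
Proof.
move=> P0 PD Pprod _ [r [c [Cc ->]]].
by apply: big_ind => // k _; exact: Pprod.
Qed.

Lemma product_cone_mull n (C : 'I_n -> set A) i t :
  (forall c, C i c -> C i (t * c)) ->
  forall x, product_cone C x -> product_cone C (t * x).
Proof.
move=> tC; apply: product_cone_ind.
- by rewrite mulr0; exact: product_cone0.
- by move=> x y ? ?; rewrite mulrDr; exact: product_coneD.
move=> c Cc; rewrite (bigD1 i)//= mulrA.
pose d j := if j == i then t * c i else c j.
have -> : t * c i * \prod_(j < n | j != i) c j = \prod_j d j.
  rewrite [RHS](bigD1 i)//= /d eqxx; congr (_ * _).
  by apply: eq_bigr => j /negbTE ->.
by apply: product_cone_prod => j; rewrite /d; case: eqP => [->|_] //; exact: tC.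
Qed.

Lemma product_cone_sub n (C : 'I_n -> set A) i :
  (forall j, C j 1) -> C i `<=` product_cone C.
Proof.
move=> C1 c Cc.
have -> : c = \prod_j (if j == i then c else 1).
  by rewrite (bigD1 i)//= eqxx big1 ?mulr1// => j /negbTE ->.
by apply: product_cone_prod => j; case: eqP => [->|].
Qed.

Lemma product_cone_unital_cone n (B C : 'I_n.+1 -> set A) :
  (forall j, unital_cone (B j) (C j)) -> unital_cone setT (product_cone C).
Proof.
move=> coneC; split; last first.
  apply: (product_cone_sub (i := ord0)); last by case: (coneC ord0).
  by move=> j; case: (coneC j).
split=> // [l c l0|]; last exact: product_coneD.
rewrite -mulr_algl; apply: (product_cone_mull (i := ord0)) => x.
by rewrite mulr_algl; case: (coneC ord0) => -[_ + _] _; apply.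
Qed.

(** Bound the factors one at a time: [m * l - c * p] equals
    [m * (l - p) + (m - c) * p], and in the last term [m - c] occupies the slot
    that [p] does not use. *)
Lemma product_cone_bounded n (B C : 'I_n.+1 -> set A) c :
    (forall j, unital_cone (B j) (C j)) -> (forall j, archimedean (B j) (C j)) ->
  product_cone C c -> exists2 l : R, 0 <= l & product_cone C (scal l - c).
Proof.
move=> coneC archC; have coneP := product_cone_unital_cone coneC.
have C1 j : C j 1 by case: (coneC j).
move: c; apply: product_cone_ind.
- by exists 0; rewrite // rmorph0 subr0; exact: product_cone0.
- move=> x y [l l0 Cl] [m m0 Cm]; exists (l + m); first exact: addr_ge0.
  have -> : scal (l + m) - (x + y) = (scal l - x) + (scal m - y).
    by rewrite rmorphD; ring.
  exact: product_coneD.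
move=> c Cc.
suff bdd s : uniq s ->
    exists2 l : R, 0 <= l & product_cone C (scal l - \prod_(j <- s) c j).
  exact: (bdd _ (index_enum_uniq 'I_n.+1)).
elim: s => [_|i s IHs /= /andP[i_s s_uniq]].
  exists 1 => //; rewrite big_nil rmorph1 subrr; exact: product_cone0.
have [l l0 Cl] := IHs s_uniq.
have [m [m0 Cm _]] : exists m : R,
    [/\ 0 < m, C i (scal m - c i) & C i (scal m + c i)].
  by apply: archC; case: (coneC i) => -[+ _ _] _; apply.
exists (m * l); first by rewrite mulr_ge0// ltW.
have -> : scal (m * l) - \prod_(j <- i :: s) c j
    = scal m * (scal l - \prod_(j <- s) c j)
      + (scal m - c i) * \prod_(j <- s) c j.
  by rewrite big_cons rmorphM; ring.
apply: product_coneD; first by apply: (unital_coneZ coneP) => //; exact: ltW.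
pose d j := if j == i then scal m - c i else if j \in s then c j else 1.
have -> : (scal m - c i) * \prod_(j <- s) c j = \prod_j d j.
  rewrite [RHS](bigD1 i)//= {1}/d eqxx; congr (_ * _).
  rewrite big_uniq//= [LHS]big_mkcond [RHS]big_mkcond /=.
  apply: eq_bigr => j _; rewrite /d; case: eqP => [->|//] /=.
  by rewrite (negbTE i_s).
apply: product_cone_prod => j; rewrite /d; case: eqP => [->//|_].
by case: ifP.
Qed.

End ProductCone.

(** * Archimedean multipliers and the main theorem *)

Section TensorPositivstellensatz.
Context {R : realType} {A : comAlgType R}.

Local Notation scal := (in_alg A).

Lemma subalgebra_of_generators (I : Type) (B : I -> set A) (S : set A) :
    generated_subalgebra (\bigcup_(i in [set: I]) B i) = [set: A] ->
  subalgebra S -> (forall i, B i `<=` S) -> forall x, S x.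
Proof.
move=> genB subS BS x.
have : generated_subalgebra (\bigcup_(i in [set: I]) B i) x by rewrite genB.
by apply; split => // y [i _ /BS].
Qed.

(** If [C i] is a semiring, its elements are themselves multipliers. If it is a
    quadratic module, only the squares of [B i] are multipliers at first; the
    square root argument adds [l - b ^+ 2], after which
    [2 * ((l + 1) / 2 - b) = (l - b ^+ 2) + (b - 1) ^+ 2] bounds [b]. *)
Lemma archimedean_multipliers n (B C : 'I_n.+1 -> set A) i :
    (forall j, subalgebra (B j)) ->
    (forall j, unital_cone (B j) (C j)) -> (forall j, archimedean (B j) (C j)) ->
    semiring (B i) (C i) \/ quadratic_module (B i) (C i) ->
  archimedean (B i) (multipliers (cone_closure (product_cone C))).
Proof.
move=> subB coneC archC hC b Bb.
have coneP := product_cone_unital_cone coneC.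
have sub_i : C i `<=` product_cone C.
  by apply: product_cone_sub => j; case: (coneC j).
have coneD := cone_closure_unital_cone coneP.
have [coneT _] := multipliers_semiring coneD.
have mult_closure t l : 0 < l -> C i (scal l - t) ->
    (forall c, C i c -> C i (t * c)) ->
    multipliers (cone_closure (product_cone C)) t.
  move=> l0 /sub_i Clt tC; apply: (multipliers_closure coneP l0 Clt) => c Cc.
  by apply: (cone_closure_sub coneP); exact: (product_cone_mull tC).
have bddC c : B i c -> exists2 l : R, 0 < l & C i (scal l - c).
  by move=> /(archC i)[l [l0 Cl _]]; exists l.
have [BiC1 _] := coneC i.
have CB : C i `<=` B i by case: BiC1.
have /subalgebraP[B1 BL BM] := subB i.
case: hC => [[_ CM]|[_ sqrC]].
  have [l [l0 Cm Cp]] := archC i b Bb.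
  have CiT : C i `<=` multipliers (cone_closure (product_cone C)).
    move=> c Cc; have [m m0 Cmc] := bddC c (CB c Cc).
    by apply: (mult_closure c m) => // d Cd; exact: CM.
  by exists l; split => //; exact: CiT.
have sqrT x : B i x -> multipliers (cone_closure (product_cone C)) (x ^+ 2).
  move=> Bx; have [m m0 Cmx] := bddC (x ^+ 2) (BM _ _ Bx Bx).
  by apply: (mult_closure _ m) => // c Cc; exact: sqrC.
have [l l0 Clb] := bddC (b ^+ 2) (BM _ _ Bb Bb).
have li0 : 0 <= l^-1 by rewrite invr_ge0 ltW.
have B0 : B i 0 by exact: CB (unital_cone0 (coneC i)).
have yC c : C i c -> C i (scal l^-1 * b ^+ 2 * c).
  by move=> Cc; rewrite -mulrA; apply: (unital_coneZ (coneC i)) => //;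
     exact: sqrC.
have liC : scal l^-1 * scal l = 1 by rewrite -rmorphM mulVf ?rmorph1 ?gt_eqF.
have T_le : multipliers (cone_closure (product_cone C)) (scal l - b ^+ 2).
  have -> : scal l - b ^+ 2 = scal l * (1 - scal l^-1 * b ^+ 2).
    by rewrite mulrBr mulrA [scal l * scal _]mulrC liC mulr1 mul1r.
  apply: (unital_coneZ coneT (ltW l0)).
  apply: (@multipliers_closure _ _ _ _ 1 coneP) => //.
    rewrite rmorph1 opprB addrC subrK; apply: sub_i.
    by rewrite -[X in C i X]mulr1; apply: yC; case: (coneC i).
  move=> c Cc; apply: (one_sub_mul_closure (subB i) coneP) => //.
  - by move=> d; exact: product_cone_bounded coneC archC.
  - by move=> x d Bx; apply: (product_cone_mull (i := i)) => e; exact: sqrC.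
  - rewrite mulr_algl -[_ *: _]addr0; apply: (BL) => //; exact: BM.
  - by apply: (product_cone_mull (i := i)).
  apply: sub_i; have -> : 1 - scal l^-1 * b ^+ 2 = scal l^-1 * (scal l - b ^+ 2).
    by rewrite mulrBr liC.
  exact: (unital_coneZ (coneC i)).
have two0 : (0 : R) < 2 by [].
exists ((l + 1) / 2); split; first by lra.
  apply: (unital_cone_scalK coneT two0).
  have -> : scal 2 * (scal ((l + 1) / 2) - b) = (scal l - b ^+ 2) + (b - 1) ^+ 2.
    rewrite mulrBr -rmorphM mulrC divfK ?pnatr_eq0//.
  by rewrite rmorphD rmorph1 rmorph_nat; ring.
  apply: (unital_coneD coneT) => //; apply: sqrT.
  by rewrite addrC -scaleN1r; exact: BL.
apply: (unital_cone_scalK coneT two0).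
have -> : scal 2 * (scal ((l + 1) / 2) + b) = (scal l - b ^+ 2) + (b + 1) ^+ 2.
  rewrite mulrDr -rmorphM mulrC divfK ?pnatr_eq0//.
  by rewrite rmorphD rmorph1 rmorph_nat; ring.
apply: (unital_coneD coneT) => //; apply: sqrT.
by rewrite -[b]scale1r; exact: BL.
Qed.

Lemma product_cone_positivstellensatz n (B C : 'I_n.+1 -> set A) a :
    (forall i, subalgebra (B i)) ->
    generated_subalgebra (\bigcup_(i in [set: 'I_n.+1]) B i) = [set: A] ->
    (forall i, archimedean (B i) (C i) /\
               (semiring (B i) (C i) \/ quadratic_module (B i) (C i))) ->
    (forall chi : {lrmorphism A -> R | *%R},
      (forall i, char_nonneg (C i) chi) -> 0 < chi a) ->
  exists2 e : R, 0 < e & product_cone C (a - e%:A).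
Proof.
move=> subB genB hC a_gt0.
have coneC i : unital_cone (B i) (C i) by case: (hC i) => _ [[]|[]].
have archC i : archimedean (B i) (C i) by case: (hC i).
have coneP := product_cone_unital_cone coneC.
have coneD := cone_closure_unital_cone coneP.
pose D := cone_closure (product_cone C).
have srT : semiring setT (multipliers D) := multipliers_semiring coneD.
have archT : archimedean setT (multipliers D).
  move=> x _.
  apply: (subalgebra_of_generators genB (bounded_subalgebra srT)) => i y Biy.
  by apply: (archimedean_multipliers subB coneC archC _ Biy); case: (hC i).
have [||d d0 Dad] :=
  archimedean_module_positivstellensatz (M := D) (a := a) srT archT.
- by split => // t x; exact.
- move=> chi chi_ge0; apply: a_gt0 => i c Cc; apply: chi_ge0.
  apply: (cone_closure_sub coneP); apply: product_cone_sub Cc => j.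
  by case: (coneC j).
exists (d / 2); first by lra.
have d20 : 0 < d / 2 by lra.
have -> : a - (d / 2)%:A = a - d%:A + scal (d / 2).
  by rewrite -addrA -scaleNr -scaleNr -scalerDl; congr (a + _ *: _); lra.
exact: Dad.
Qed.

(** The case of an empty family, where the cone of the family, formed by the
    natural numbers, is not closed under scaling. The Positivstellensatz is
    applied to the nonnegative scalars instead. *)
Lemma scalar_algebra_positivstellensatz (a : A) :
    (forall x : A, exists l : R, x = l%:A) ->
    (forall chi : {lrmorphism A -> R | *%R}, 0 < chi a) ->
  exists2 e : R, 0 < e & a = e%:A.
Proof.
move=> scalA a_gt0.
pose T : set A := [set x | exists2 l : R, 0 <= l & x = l%:A].
have srT : semiring setT T.
  split; last first.
    move=> _ _ [l l0 ->] [m m0 ->]; exists (l * m); first exact: mulr_ge0.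
    by rewrite -scalerAl mul1r scalerA.
  split; last by exists 1 => //; rewrite scale1r.
  split => // [l _ l0 [m m0 ->]|_ _ [l l0 ->] [m m0 ->]].
    by exists (l * m); [exact: mulr_ge0|rewrite scalerA].
  by exists (l + m); [exact: addr_ge0|rewrite scalerDl].
have archT : archimedean setT T.
  move=> x _; have [l ->] := scalA x; exists (`|l| + 1).
  have := ler_norm l; have := ler_norm (- l); rewrite normrN => h1 h2.
  split; first by lra.
    by exists (`|l| + 1 - l); [lra|rewrite scalerBl].
  by exists (`|l| + 1 + l); [lra|rewrite [RHS]scalerDl].
have [||d d0 [l l0 E]] :=
  archimedean_module_positivstellensatz (M := T) (a := a) srT archT.
- by case: srT.
- by move=> chi _; exact: a_gt0.
by exists (d + l); [lra|rewrite scalerDl -E addrC subrK].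
Qed.

End TensorPositivstellensatz.

Theorem corollary3 (R : realType) (A : comAlgType R) (m : nat)
    (A_ : 'I_m -> set A) (C_ : 'I_m -> set A)
    (subA : forall i, subalgebra (A_ i))
    (genA : generated_subalgebra (\bigcup_(i in [set: 'I_m]) A_ i) = [set: A])
    (hC : forall i, archimedean (A_ i) (C_ i) /\
                    (semiring (A_ i) (C_ i) \/ quadratic_module (A_ i) (C_ i)))
    (a : A) :
  (forall chi : {lrmorphism A -> R | *%R},
     (\bigcap_(i in [set: 'I_m]) char_nonneg (C_ i)) chi -> 0 < chi a)
  <->
  (exists eps : R, 0 < eps /\
     [set eps%:A + c | c in product_cone C_] a).
Proof.
split=> [a_gt0|[eps [eps0 [c Cc <-]]] chi chi_ge0]; last first.
  have chi_c : 0 <= chi c.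
    move: c Cc; apply: product_cone_ind; first by rewrite rmorph0.
      by move=> x y x0 y0; rewrite rmorphD; exact: addr_ge0.
    by move=> c Cc; rewrite rmorph_prod; apply: prodr_ge0 => i _; exact: chi_ge0.
  by rewrite linearD linearZ_LR rmorph1 /= mulr1 ltr_wpDr.
case: m A_ C_ subA genA hC a_gt0 => [|n] B C subB genB hC a_gt0.
  have [||e e0 ->] := @scalar_algebra_positivstellensatz R A a.
  - apply: (subalgebra_of_generators genB) => [|[]//].
    apply/subalgebraP; split; first by exists 1; rewrite scale1r.
      move=> l _ _ [r ->] [s ->]; exists (l * r + s).
      by rewrite scalerA scalerDl.
    by move=> _ _ [r ->] [s ->]; exists (r * s); rewrite -scalerAl mul1r scalerA.
  - by move=> chi; apply: a_gt0 => -[].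
  by exists e; split=> //; exists 0; rewrite ?addr0//; exact: product_cone0.
have [e e0 Cae] := product_cone_positivstellensatz subB genB hC
  (fun chi h => a_gt0 chi (fun i _ => h i)).
by exists e; split => //; exists (a - e%:A) => //; rewrite addrC subrK.
Qed.
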